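(* For every nonnegative integer $n$, \begin{align*} \overline{a}_5(20n+6) &= 20\,\overline{b}_5(10n),\\ \overline{a}_5(20n+14) &= 20\,\overline{b}_5(10n+4). \end{align*}
   Context: For $j\ge1$ let $f_j:=\prod_{k\ge 1}(1-q^{jk})$ (for $|q|<1$, or as a formal power series). Let $\varphi(-q):=\sum_{n=-\infty}^{\infty}(-1)^n q^{n^2}=f_1^2/f_2$ and $\psi(-q):=\sum_{n=0}^{\infty}(-q)^{n(n+1)/2}=f_1f_4/f_2$, so that $\varphi(-q^5)=f_5^2/f_{10}$ and $\psi(-q^5)=f_5f_{20}/f_{10}$. The integers $\overline{a}_5(n)$ and $\overline{b}_5(n)$ are defined by $$\sum_{n=0}^\infty \overline{a}_5(n)q^n=\frac{\varphi^5(-q^5)}{\varphi(-q)}=1+2q+4q^2+8q^3+14q^4+14q^5+20q^6+24q^7+\cdots,$$ $$\sum_{n=0}^\infty \overline{b}_5(n)q^n=\frac{\psi^5(-q^5)}{\psi(-q)}=1+q+q^2+2q^3+3q^4-q^5+2q^7-2q^9+6q^{10}+\cdots .$$ *)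

(* Defs.v *)
From HB Require Import structures.
From mathcomp Require Import all_boot all_order all_algebra.
Set Implicit Arguments.
Unset Strict Implicit.
Unset Printing Implicit Defensive.
Import Order.TTheory GRing.Theory Num.Theory.
Local Open Scope ring_scope.

(* Formal power series in q with integer coefficients: [f n] is the
   coefficient of q^n. *)
Definition pseries := nat -> int.

Definition psone : pseries := fun n => (n == 0%N)%:R.

Definition psmul (f g : pseries) : pseries :=
  fun n => \sum_(i < n.+1) f i * g (n - i)%N.

Definition psexp (f : pseries) (k : nat) : pseries := iter k (psmul f) psone.

(* The substitution q := q^k, for k > 0. *)
Definition psdil (k : nat) (f : pseries) : pseries :=
  fun n => if (k %| n)%N then f (n %/ k)%N else 0.

(* The quotient g / f is the usual one when the constant term of f is a unit
   (lemmas psdivK and psdiv_uniq); its coefficients are computed recursively,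
   [psdiv_seq g f n] listing the first n of them. *)
Fixpoint psdiv_seq (g f : pseries) (n : nat) : seq int :=
  if n is m.+1 then
    let s := psdiv_seq g f m in
    rcons s ((g m - \sum_(i < m) s`_i * f (m - i)%N) / f 0%N)
  else [::].

Definition psdiv (g f : pseries) : pseries :=
  fun n => (psdiv_seq g f n.+1)`_n.

(* phi(-q) = \sum_(k in Z) (-1)^k q^(k^2). The exponent m only arises from
   integers k with |k| <= m, written here k = i - m with 0 <= i <= 2m. *)
Definition phi_neg : pseries :=
  fun m => \sum_(i < (2 * m).+1 | (i%:Z - m%:Z) ^+ 2 == m%:Z)
             (-1) ^ (i%:Z - m%:Z).

(* psi(-q) = \sum_(k >= 0) (-q)^(k(k+1)/2). The exponent m only arises from
   k <= m. *)
Definition psi_neg : pseries :=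
  fun m => \sum_(k < m.+1 | (k * k.+1)./2 == m) (-1) ^+ (k * k.+1)./2.

Definition abar5 : pseries := psdiv (psexp (psdil 5 phi_neg) 5) phi_neg.

Definition bbar5 : pseries := psdiv (psexp (psdil 5 psi_neg) 5) psi_neg.

Lemma size_psdiv_seq g f n : size (psdiv_seq g f n) = n.
Proof. by elim: n => //= n IHn; rewrite size_rcons IHn. Qed.

Lemma nth_psdiv_seq g f n i : (i < n)%N -> (psdiv_seq g f n)`_i = psdiv g f i.
Proof.
elim: n => // n IHn; rewrite ltnS leq_eqVlt => /orP[/eqP-> // | lt_in].
by rewrite /= nth_rcons size_psdiv_seq lt_in IHn.
Qed.

Lemma psdiv_rec g f n :
  psdiv g f n = (g n - \sum_(i < n) psdiv g f i * f (n - i)%N) / f 0%N.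
Proof.
rewrite {1}/psdiv /= nth_rcons size_psdiv_seq ltnn eqxx.
by congr ((_ - _) / _); apply: eq_bigr => i _; rewrite nth_psdiv_seq.
Qed.

Lemma psdivK g f :
  f 0%N \is a GRing.unit -> psmul (psdiv g f) f =1 g.
Proof.
move=> f0U n; rewrite /psmul big_ord_recr /= subnn [psdiv g f n]psdiv_rec.
by rewrite divrK // addrC subrK.
Qed.

Lemma psdiv_uniq g f h :
  f 0%N \is a GRing.unit -> psmul h f =1 g -> h =1 psdiv g f.
Proof.
move=> f0U hfg n; elim/ltn_ind: n => n IHn.
rewrite psdiv_rec -hfg /psmul big_ord_recr /= subnn.
rewrite (eq_bigr (fun i : 'I_n => psdiv g f i * f (n - i)%N)); last first.
  by move=> i _; rewrite IHn.
by rewrite addrC addrK mulrK.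
Qed.

Lemma phi_neg0 : phi_neg 0 = 1.
Proof. by rewrite /phi_neg big_mkcond big_ord1. Qed.

Lemma psi_neg0 : psi_neg 0 = 1.
Proof. by rewrite /psi_neg big_mkcond big_ord1. Qed.

(* Main.v *)
(* Write phi(q) and psi(q) for the two theta series. All the identities needed
   are consequences of a single relation between phi(q), phi(q^5), psi(q^2) and
   psi(q^10) (phi_psi2), which counts vectors of a four-dimensional lattice:
   split the Gaussian integers by parity and modulo 2 + i, and send (z, z') to
   ((z + z') / (1 + i), (z - z') / (1 + i)). Together with its image under
   q -> -q and phi(q)^4 - phi(-q)^4 = 16 q psi(q^2)^4, it puts phi(q^5)/phi(q),
   phi(-q^5)/phi(-q) and q psi(q^10)/psi(q^2) on an explicit curve of genus one,
   on which the following two facts are polynomial identities. First, the even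
   part of phi(-q^5)^5 / phi(-q) is obtained by q -> q^2 from
     psi^5/Psi - q psi^3 Psi + 7 q^2 psi Psi^3 + q^3 Psi^5/psi,
   where psi = psi(q) and Psi = psi(q^5). Second, this series differs from
     20 q^3 Psi^5/psi + 2 phi(q) phi(q^5)^3
   by an even function of q. The last term has no exponent congruent to 2 or 3
   mod 5, because these are not squares mod 5. *)

Require Import Defs.
From HB Require Import structures.
From mathcomp Require Import all_boot all_order all_algebra.
From mathcomp Require Import boolp classical_sets functions cardinality fsbigop.
From mathcomp Require Import ring zify.
Set Implicit Arguments.
Unset Strict Implicit.
Unset Printing Implicit Defensive.
Import Order.TTheory GRing.Theory Num.Theory.
Local Open Scope ring_scope.

(** * Formal power series *)

Definition fps := nat -> int.
Identity Coercion fun_of_fps : fps >-> Funclass.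

Lemma fpsP (f g : fps) : f =1 g -> f = g.
Proof. exact: funext. Qed.

HB.instance Definition _ := gen_eqMixin fps.
HB.instance Definition _ := gen_choiceMixin fps.

Definition fps_zero : fps := fun _ => 0.
Definition fps_opp (f : fps) : fps := fun n => - f n.
Definition fps_add (f g : fps) : fps := fun n => f n + g n.

Lemma fps_addA : associative fps_add.
Proof. by move=> f g h; apply: fpsP => n; rewrite /fps_add addrA. Qed.
Lemma fps_addC : commutative fps_add.
Proof. by move=> f g; apply: fpsP => n; rewrite /fps_add addrC. Qed.
Lemma fps_add0 : left_id fps_zero fps_add.
Proof. by move=> f; apply: fpsP => n; rewrite /fps_add add0r. Qed.
Lemma fps_addN : left_inverse fps_zero fps_opp fps_add.
Proof. by move=> f; apply: fpsP => n; rewrite /fps_add /fps_opp addNr. Qed.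

HB.instance Definition _ :=
  GRing.isZmodule.Build fps fps_addA fps_addC fps_add0 fps_addN.

Lemma psmulC (f g : fps) : psmul f g =1 psmul g f.
Proof.
move=> n; rewrite /psmul (reindex_inj rev_ord_inj) /=; apply: eq_bigr => i _.
by rewrite mulrC subSS subKn // -ltnS.
Qed.

(* The coefficients of a product only depend on truncations, so the ring
   laws are inherited from polynomials. *)
Definition trunc (f : fps) n : {poly int} := \poly_(i < n.+1) f i.

Lemma coef_trunc f n i : (i <= n)%N -> (trunc f n)`_i = f i.
Proof. by move=> le_in; rewrite coef_poly ltnS le_in. Qed.

Lemma coef_psmul f g n m i :
  (i <= n)%N -> (i <= m)%N -> psmul f g i = (trunc f n * trunc g m)`_i.
Proof.
move=> le_in le_im; rewrite coefM; apply: eq_bigr => j _.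
rewrite !coef_trunc //; first exact: leq_trans (leq_subr _ _) le_im.
exact: leq_trans (leq_ord j) le_in.
Qed.

Lemma psmulA : associative (psmul : fps -> fps -> fps).
Proof.
move=> f g h; apply: fpsP => n.
transitivity ((trunc f n * (trunc g n * trunc h n))`_n).
  rewrite coefM; apply: eq_bigr => j _; rewrite coef_trunc ?leq_ord //.
  by rewrite -coef_psmul // leq_subr.
rewrite mulrA coefM; apply: eq_bigr => j _; rewrite coef_trunc ?leq_subr //.
by rewrite -coef_psmul // leq_ord.
Qed.

Lemma psmul1 : left_id (psone : fps) psmul.
Proof.
move=> f; apply: fpsP => n; rewrite /psmul big_ord_recl subn0 mul1r big1 ?addr0 //.
by move=> i _; rewrite mul0r.
Qed.

Lemma psmulDl : left_distributive (psmul : fps -> fps -> fps) fps_add.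
Proof.
move=> f g h; apply: fpsP => n; rewrite /psmul /fps_add -big_split /=.
by apply: eq_bigr => i _; rewrite mulrDl.
Qed.

Lemma psone_neq0 : (psone : fps) != 0.
Proof. by apply/eqP => /(congr1 (fun f : fps => f 0%N)). Qed.

HB.instance Definition _ := GRing.Zmodule_isComNzRing.Build fps
  psmulA (fun f g => fpsP (psmulC f g)) psmul1 psmulDl psone_neq0.

Definition fps_unit (f : fps) : bool := f 0%N \is a GRing.unit.
(** Non-units are sent to themselves, the convention that the unit ring structure demands. *)
Definition fps_inv (f : fps) : fps := if fps_unit f then psdiv psone f else f.

Lemma fcoef0M (f g : fps) : (f * g) 0%N = f 0%N * g 0%N.
Proof. by rewrite [LHS]big_ord1. Qed.

Lemma fps_mulVx : {in fps_unit, left_inverse 1 fps_inv *%R}.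
Proof.
move=> f fU; have {}fU : fps_unit f by [].
by rewrite /fps_inv fU; apply: fpsP; exact: (@psdivK psone f fU).
Qed.

Lemma fps_unitPl (f g : fps) : g * f = 1 -> fps_unit f.
Proof.
move=> gf1; apply/unitrPr; exists (g 0%N).
by rewrite mulrC -fcoef0M gf1.
Qed.

Lemma fps_inv_out : {in [predC fps_unit], fps_inv =1 id}.
Proof. by move=> f fU; rewrite /fps_inv ifF //; apply: negbTE. Qed.

HB.instance Definition _ := GRing.ComNzRing_hasMulInverse.Build fps
  fps_mulVx fps_unitPl fps_inv_out.

(** The lowest nonzero coefficients, of index [i] and [j], multiply to the coefficient of index
    [i + j] of the product. *)
Lemma fps_idomain : GRing.integral_domain_axiom fps.
Proof.
move=> f g fg0; apply/norP => -[/eqP nf /eqP ng].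
have exn (h : fps) : h <> 0 -> exists n, h n != 0.
  move=> nh; apply: contrapT => /forallNP h0; apply: nh; apply: fpsP => n.
  by apply: contrapT => /eqP /h0.
have [i fi mini] := ex_minnP (exn _ nf); have [j gj minj] := ex_minnP (exn _ ng).
have f0 k : (k < i)%N -> f k = 0.
  by move=> lt_ki; apply/eqP; apply: contraLR lt_ki => /mini; rewrite -leqNgt.
have g0 k : (k < j)%N -> g k = 0.
  by move=> lt_kj; apply/eqP; apply: contraLR lt_kj => /minj; rewrite -leqNgt.
have := congr1 (fun h : fps => h (i + j)%N) fg0.
have lt_i : (i < (i + j).+1)%N by rewrite ltnS leq_addr.
rewrite [LHS](bigD1 (Ordinal lt_i)) //= big1 => [|k ne_ki].
  rewrite addr0 addKn => /eqP; rewrite mulf_eq0.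
  by rewrite (negbTE fi) (negbTE gj).
have [/f0-> | le_ik] := ltnP k i; first by rewrite mul0r.
rewrite [g _]g0 ?mulr0 //.
have ltik : (i < k)%N by rewrite ltn_neqAle le_ik andbT eq_sym.
by have := ltn_ord k; lia.
Qed.

HB.instance Definition _ := GRing.ComUnitRing_isIntegral.Build fps fps_idomain.

Lemma fcoefD (f g : fps) n : (f + g) n = f n + g n. Proof. by []. Qed.
Lemma fcoefN (f : fps) n : (- f) n = - f n. Proof. by []. Qed.
Lemma fcoefB (f g : fps) n : (f - g) n = f n - g n. Proof. by []. Qed.
Lemma fcoef1 n : (1 : fps) n = (n == 0%N)%:R. Proof. by []. Qed.
Lemma fcoef0 n : (0 : fps) n = 0. Proof. by []. Qed.
Lemma fcoefM (f g : fps) n : (f * g) n = \sum_(i < n.+1) f i * g (n - i)%N.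
Proof. by []. Qed.

Lemma fcoef_mulrn (f : fps) k n : (f *+ k) n = f n *+ k.
Proof. by elim: k => // k IHk; rewrite !mulrS fcoefD IHk. Qed.

Lemma fcoef_natM k (f : fps) n : (k%:R * f) n = k%:R * f n.
Proof. by rewrite !mulr_natl fcoef_mulrn. Qed.

Lemma fcoef0X (f : fps) k : (f ^+ k) 0%N = f 0%N ^+ k.
Proof. by elim: k => // k IHk; rewrite !exprS fcoef0M IHk. Qed.

Lemma fcoef1M (f g : fps) : (f * g) 1%N = f 0%N * g 1%N + f 1%N * g 0%N.
Proof. by rewrite fcoefM 2!big_ord_recl big_ord0 addr0. Qed.

Definition fpsX : fps := fun n => (n == 1%N)%:R.

Lemma fcoefXM (f : fps) n : (fpsX * f) n = if n is m.+1 then f m else 0.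
Proof.
case: n => [|n]; first by rewrite fcoef0M mul0r.
rewrite fcoefM 2!big_ord_recl mul0r add0r mul1r subSS subn0.
by rewrite big1 ?addr0 // => i _; rewrite mul0r.
Qed.

Lemma fcoefXnM (f : fps) k n :
  (fpsX ^+ k * f) n = if (k <= n)%N then f (n - k)%N else 0.
Proof.
elim: k n => [|k IHk] [|n]; rewrite ?mul1r ?subn0 // exprS -mulrA fcoefXM //.
Qed.

(** * The substitutions q -> q^k and q -> -q *)

Definition dil k (f : fps) : fps := psdil k f.

Section Dilation.
Variables (k : nat) (k0 : (0 < k)%N).

Lemma coef_dil f n : dil k f (k * n)%N = f n.
Proof. by rewrite /dil /psdil dvdn_mulr // mulKn. Qed.

Lemma coef_dilN f n : ~~ (k %| n)%N -> dil k f n = 0.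
Proof. by rewrite /dil /psdil => /negbTE->. Qed.

Lemma dilM f g : dil k (f * g) = dil k f * dil k g.
Proof.
apply: fpsP => n; have [/dvdnP[m ->{n}] | ndv] := boolP (k %| n)%N; last first.
  rewrite coef_dilN // fcoefM big1 // => i _.
  have [ki | /coef_dilN->] := boolP (k %| i)%N; last by rewrite mul0r.
  rewrite [dil k g _]coef_dilN ?mulr0 //; apply: contra ndv => kni.
  by rewrite -(subnKC (leq_ord i)) dvdn_add.
rewrite mulnC coef_dil !fcoefM.
rewrite [RHS](bigID (fun i : 'I_ _ => k %| i)%N) /=.
rewrite [X in _ + X]big1 ?addr0; last first.
  by move=> i ki; rewrite coef_dilN ?mul0r.
have ltk (i : 'I_m.+1) : (k * i < (k * m).+1)%N.
  by rewrite ltnS leq_pmul2l // -ltnS.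
rewrite [RHS](reindex_onto (fun i => Ordinal (ltk i))
                           (fun i => inord (i %/ k))) /=.
  apply: eq_big => [i | i _]; last by rewrite -mulnBr !coef_dil.
  by rewrite dvdn_mulr // mulKn // inord_val eqxx.
move=> i ki; apply: val_inj; rewrite /= inordK ?[RHS]divnK 1?mulnC ?divnK //.
by rewrite ltnS leq_divLR // [(m * k)%N]mulnC -ltnS.
Qed.

Lemma dil_inj : injective (dil k).
Proof.
by move=> f g fg; apply: fpsP => n; rewrite -coef_dil fg coef_dil.
Qed.

Lemma dilX n : dil k (fpsX ^+ n) = fpsX ^+ (k * n).
Proof.
have E (m : nat) : fpsX ^+ m = (fun i => (i == m)%:R) :> fps.
  apply: fpsP => i; rewrite -[fpsX ^+ m]mulr1 fcoefXnM fcoef1 subn_eq0.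
  by case: ltngtP.
rewrite !E; apply: fpsP => i; rewrite /dil /psdil.
case: ifP => [/dvdnP[j ->] | ndv]; first by rewrite mulnK // mulnC eqn_pmul2l.
by case: eqP ndv => // ->; rewrite dvdn_mulr.
Qed.

End Dilation.

Lemma dil_dil k l m f :
  (k * l = m)%N -> (0 < m)%N -> dil k (dil l f) = dil m f.
Proof.
move=> <-{m}; rewrite muln_gt0 => /andP[k0 l0]; apply: fpsP => n.
have [/dvdnP[m ->{n}] | ndv] := boolP (k %| n)%N; last first.
  rewrite !coef_dilN //; apply: contra ndv; exact/dvdn_trans/dvdn_mulr.
rewrite mulnC coef_dil //; have [/dvdnP[j ->] | ndv] := boolP (l %| m)%N.
  by rewrite [(j * l)%N]mulnC coef_dil // mulnA coef_dil ?muln_gt0 ?k0.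
by rewrite !coef_dilN // dvdn_pmul2l.
Qed.

(* The substitution q := - q. *)
Definition flip (f : fps) : fps := fun n => (-1) ^+ n * f n.

Lemma flipM f g : flip (f * g) = flip f * flip g.
Proof.
apply: fpsP => n; rewrite /flip !fcoefM mulr_sumr; apply: eq_bigr => i _.
by rewrite mulrACA -exprD subnKC // -ltnS.
Qed.

(** The index is a successor so that the morphism instances carry no side condition [0 < k];
    numerals such as 5 match it. *)
Lemma dil_zmod_morphism k : zmod_morphism (dil k.+1).
Proof.
move=> f g; apply: fpsP => n; rewrite fcoefB /dil /psdil.
by case: ifP => // _; rewrite subr0.
Qed.

Lemma dil_monoid_morphism k : monoid_morphism (dil k.+1).
Proof.
by split=> [|f g]; [have := @dilX k.+1 isT 0; rewrite muln0 | exact: dilM].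
Qed.

HB.instance Definition _ k :=
  GRing.isZmodMorphism.Build fps fps (dil k.+1) (dil_zmod_morphism k).
HB.instance Definition _ k :=
  GRing.isMonoidMorphism.Build fps fps (dil k.+1) (dil_monoid_morphism k).

Lemma flip_zmod_morphism : zmod_morphism flip.
Proof. by move=> f g; apply: fpsP => n; rewrite fcoefB /flip !fcoefB mulrBr. Qed.

Lemma flip_monoid_morphism : monoid_morphism flip.
Proof.
split=> [|f g]; last exact: flipM.
by apply: fpsP => -[|n]; rewrite /flip !fcoef1 ?mulr1 ?mulr0.
Qed.

HB.instance Definition _ :=
  GRing.isZmodMorphism.Build fps fps flip flip_zmod_morphism.
HB.instance Definition _ :=
  GRing.isMonoidMorphism.Build fps fps flip flip_monoid_morphism.

(** * Lattice sums *)

Definition level (T : choiceType) (P : pred T) (e : T -> nat) (n : nat) : set T :=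
  [set x | P x && (e x == n)].

Definition locfin (T : choiceType) (P : pred T) (e : T -> nat) :=
  forall n, finite_set (level P e n).

(* Junk value: a coefficient is 0 when its level set is infinite, whence the
   [locfin] hypotheses below. *)
Definition gf (T : choiceType) (P : pred T) (e : T -> nat) : fps :=
  fun n => \sum_(x \in level P e n) (1 : int).

Lemma locfin_sub (T : choiceType) (P Q : pred T) e :
  (forall x, P x -> Q x) -> locfin Q e -> locfin P e.
Proof.
move=> sPQ Qfin n; apply: sub_finite_set (Qfin n) => x /andP[Px ex].
by rewrite /level /= sPQ.
Qed.

Lemma locfin_prod (S T : choiceType) (P : pred S) (Q : pred T) d e :
  locfin P d -> locfin Q e ->
  locfin (fun z => P z.1 && Q z.2) (fun z => d z.1 + e z.2)%N.
Proof.
move=> Pfin Qfin n.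
apply: (@sub_finite_set _ _
  (\bigcup_(i in `I_n.+1) (level P d i `*` level Q e (n - i)%N))%classic).
  move=> [x y] /andP[/= /andP[Px Qy] /eqP <-].
  exists (d x); first by rewrite /= ltnS leq_addr.
  by rewrite /level /= Px Qy addKn !eqxx.
by apply: bigcup_finite => // i _; apply: finite_setX.
Qed.

(** The tool for every lattice bijection below: with the inverse [k] explicit, only pointwise
    arithmetic remains. *)
Lemma gf_bij (S T : choiceType) (P : pred S) (Q : pred T) d e
    (h : S -> T) (k : T -> S) :
  (forall x, P x -> [/\ Q (h x), e (h x) = d x & k (h x) = x]) ->
  (forall y, Q y -> P (k y) /\ h (k y) = y) ->
  gf P d = gf Q e.
Proof.
move=> hP kQ; apply: fpsP => n; apply/esym/(@reindex_fsbig _ _ _ _ _ h); split.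
- by move=> x /andP[/hP[Qh ed _] dx]; rewrite /level /= Qh ed.
- move=> x y; rewrite !inE => /andP[/hP[_ _ kx] _] /andP[/hP[_ _ ky] _] hxy.
  by rewrite -kx hxy ky.
- move=> y /andP[Qy ey]; have [Pk hk] := kQ y Qy; exists (k y) => //.
  by rewrite /level /= Pk; have [_ <- _] := hP _ Pk; rewrite hk.
Qed.

Lemma eq_gf (T : choiceType) (P Q : pred T) d e :
  P =1 Q -> (forall x, P x -> d x = e x) -> gf P d = gf Q e.
Proof.
move=> PQ de; apply: (@gf_bij _ _ _ _ _ _ id id) => [x Px | y Qy].
  by rewrite -PQ Px de.
by rewrite PQ.
Qed.

Lemma gfD (T : choiceType) (P Q : pred T) e :
  locfin P e -> locfin Q e -> (forall x, P x -> ~~ Q x) ->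
  gf P e + gf Q e = gf (fun x => P x || Q x) e.
Proof.
move=> Pfin Qfin PQ; apply: fpsP => n.
rewrite [LHS]fcoefD /gf -fsbigU0 //; last first.
  by move=> x [/andP[Px _] /andP[Qx _]]; have := PQ x Px; rewrite Qx.
apply: eq_fsbigl; apply/seteqP; split=> x /=.
  by case=> /andP[Ax ex]; apply/andP; rewrite Ax ?orbT.
by case/andP=> /orP[Ax | Ax] ex; [left | right]; apply/andP.
Qed.

Lemma gfM (S T : choiceType) (P : pred S) (Q : pred T) d e :
  locfin P d -> locfin Q e ->
  gf P d * gf Q e = gf (fun z => P z.1 && Q z.2) (fun z => d z.1 + e z.2)%N.
Proof.
move=> Pfin Qfin; apply: fpsP => n; rewrite fcoefM /gf.
set D := level _ _ n; have Dfin : finite_set D by exact: locfin_prod.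
(* Each pair of [D] counts for 1, written as a sum of indicators over the possible values of
   [d z.1]; exchanging the sums sorts the pairs by that value. *)
transitivity (\sum_(z \in D) \sum_(i < n.+1) ((d z.1 == i)%:R : int)); last first.
  apply: eq_fsbigr => z; rewrite inE => /andP[_ /eqP dz].
  have lt_d : (d z.1 < n.+1)%N by rewrite ltnS -dz leq_addr.
  rewrite (bigD1 (Ordinal lt_d)) //= eqxx big1 ?addr0 // => i ne_i.
  by rewrite -val_eqE /= eq_sym in ne_i; rewrite (negbTE ne_i).
under [RHS]eq_fsbigr do rewrite (fsbig_ord _ _ (fun i => (d _ == i)%:R : int)).
rewrite exchange_fsbig //=.
rewrite -(fsbig_ord _ _ (fun i => \sum_(z \in D) ((d z.1 == i)%:R : int))).
apply: eq_bigr => i _.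
rewrite -[RHS](@fsbig_widen _ _ _ _ (level P d i `*` level Q e (n - i)%N)%classic).
- transitivity
    (\sum_(z \in (level P d i `*` level Q e (n - i)%N)%classic) (1 : int)).
    rewrite -(@pair_fsbig _ _ +%R _ _ _ _ (fun _ _ => 1 : int)) //.
    by rewrite mulr_fsuml; apply: eq_fsbigr => x _; rewrite mul1r.
  by apply: eq_fsbigr => z; rewrite inE => -[/andP[_ ->]].
- move=> [x y] [/andP[Px /eqP dx] /andP[Qy /eqP ey]].
  by rewrite /D /level /= Px Qy dx ey subnKC ?eqxx // -ltnS.
- move=> [x y] [/andP[/= /andP[Px Qy] /eqP dn] /= nxy].
  case: eqP => // dx; case: nxy.
  by rewrite /level /= Px Qy -dx -dn addKn !eqxx.
Qed.

Lemma dil_gf (T : choiceType) (P : pred T) e k : (0 < k)%N ->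
  dil k (gf P e) = gf P (fun x => k * e x)%N.
Proof.
move=> k0; apply: fpsP => n; have [/dvdnP[m ->{n}] | ndv] := boolP (k %| n)%N.
  rewrite mulnC coef_dil //; apply: eq_fsbigl.
  by apply/seteqP; split=> x; rewrite /level /= eqn_pmul2l.
rewrite coef_dilN // /gf (_ : level _ _ _ = set0) ?fsbig_set0 //.
apply/seteqP; split=> // x /andP[_ /eqP def_n]; move: ndv.
by rewrite -def_n dvdn_mulr.
Qed.

Lemma mulXn_gf (T : choiceType) (P : pred T) e k :
  fpsX ^+ k * gf P e = gf P (fun x => k + e x)%N.
Proof.
apply: fpsP => n; rewrite fcoefXnM; case: leqP => [le_kn | lt_nk].
  apply: eq_fsbigl; apply/seteqP; split=> x; rewrite /level /=.
    by case/andP=> -> /eqP->; rewrite subnKC ?eqxx.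
  by case/andP=> -> /eqP<-; rewrite addKn eqxx.
rewrite /gf (_ : level _ _ _ = set0) ?fsbig_set0 //.
apply/seteqP; split=> // x /andP[_ /eqP def_n]; move: lt_nk.
by rewrite -def_n ltnNge leq_addr.
Qed.

Definition sq (x : int) : nat := absz (x * x).

Lemma sqE x : (sq x)%:Z = x * x.
Proof. by rewrite /sq gez0_abs // sqr_ge0. Qed.

Lemma locfin_sq (P : pred int) : locfin P sq.
Proof.
apply: (@locfin_sub _ _ predT) => // n.
(* An integer whose square is [n] lies between [- n] and [n]. *)
apply: (@sub_finite_set _ _ [set` [seq i%:Z - n%:Z | i <- iota 0 (2 * n).+1]]).
  move=> x /andP[_ /eqP xn]; apply/mapP; exists (absz (x + n%:Z)).
    by rewrite mem_iota; have := sqE x; nia.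
  by have := sqE x; nia.
exact: finite_seq.
Qed.

(** * Theta series *)

Definition ev (x : int) : bool := (2 %| x)%Z.
Definition od (x : int) : bool := ~~ (2 %| x)%Z.

Definition phi : fps := gf predT sq.
Definition th0 : fps := gf ev sq.
Definition th1 : fps := gf od sq.
Definition psi : fps := gf (predT : pred nat) (fun k => (k * k.+1)./2).

Lemma phi_split : phi = th0 + th1.
Proof.
rewrite /th0 /th1 gfD; try exact: locfin_sq; last by move=> x; rewrite /ev /od => ->.
by apply: eq_gf => // x; rewrite /ev /od; case: (_ %| _)%Z.
Qed.

Lemma th0_dil : th0 = dil 4 phi.
Proof.
rewrite dil_gf //.
apply: (@gf_bij _ _ _ _ _ _ (fun x => x %/ 2)%Z (fun x => 2 * x)) => [x | y _].
  rewrite /ev => ev_x; have xE : x = 2 * (x %/ 2)%Z by lia.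
  split=> //; apply/eqP; rewrite -eqz_nat PoszM !sqE [in X in _ == X]xE.
  by apply/eqP; ring.
by rewrite /ev; split; lia.
Qed.

(** Since (2k+1)^2 = 8 k(k+1)/2 + 1, the positive odd integers give q psi(q^8); their opposites give
    the same series again. *)
Lemma th1_dil : th1 = 2 * fpsX * dil 8 psi.
Proof.
pose op (x : int) := od x && (0 < x); pose on (x : int) := od x && (x < 0).
have eP : gf op sq = fpsX * dil 8 psi.
  rewrite dil_gf // -[fpsX]expr1 mulXn_gf.
  apply: (@gf_bij _ _ _ _ _ _ (fun x => absz (x %/ 2)%Z) (fun k => 2 * k%:Z + 1)).
    move=> x; rewrite /op /od => /andP[ox x0]; split=> //; last by lia.
    have xE : x = 2 * (absz (x %/ 2)%Z)%:Z + 1 by lia.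
    rewrite [in RHS]xE; move: (absz _) => k; have := sqE (2 * k%:Z + 1).
    have : ~~ odd (k * k.+1) by rewrite oddM oddS; case: odd.
    nia.
  by move=> k _; rewrite /op /od; split; lia.
have eN : gf on sq = gf op sq.
  apply: (@gf_bij _ _ _ _ _ _ -%R -%R) => x; rewrite /on /op /od.
    by rewrite /sq mulrNN opprK; split=> //; lia.
  by rewrite opprK; split=> //; lia.
transitivity (gf op sq + gf on sq); last by rewrite eN eP; ring.
rewrite gfD; try exact: locfin_sq; last by move=> x; rewrite /op /on; lia.
by apply: eq_gf => // x; rewrite /op /on /od; lia.
Qed.

(** * Gaussian integers by parity and by residue modulo 2 + i *)

Definition nrm (z : int * int) : nat := sq z.1 + sq z.2.

Lemma nrmE z : (nrm z)%:Z = z.1 ^+ 2 + z.2 ^+ 2.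
Proof. by rewrite PoszD !sqE. Qed.

Lemma locfin_nrm (P : pred (int * int)) : locfin P nrm.
Proof.
apply: (@locfin_sub _ _ (fun z => predT z.1 && predT z.2)) => //.
by apply: locfin_prod; exact: locfin_sq.
Qed.

Definition both_even (z : int * int) := ev z.1 && ev z.2.
Definition both_odd (z : int * int) := od z.1 && od z.2.
Definition odd_sum (z : int * int) := od (z.1 + z.2).

Lemma th00 : th0 * th0 = gf both_even nrm.
Proof. by rewrite gfM //; exact: locfin_sq. Qed.

Lemma th11 : th1 * th1 = gf both_odd nrm.
Proof. by rewrite gfM //; exact: locfin_sq. Qed.

(** The factor 2 accounts for the choice of the odd coordinate. *)
Lemma th01 : 2 * (th0 * th1) = gf odd_sum nrm.
Proof.
rewrite -[2]/(1 + 1) mulrDl mul1r {1}mulrC !gfM; try exact: locfin_sq.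
rewrite gfD; try exact: locfin_nrm; last by move=> [x y]; rewrite /ev /od /=; lia.
by apply: eq_gf => // -[x y]; rewrite /odd_sum /ev /od /=; lia.
Qed.

Lemma th0011 : th0 * th0 + th1 * th1 = gf (fun z => ev (z.1 + z.2)) nrm.
Proof.
rewrite th00 th11 gfD; try exact: locfin_nrm.
  by apply: eq_gf => // -[x y]; rewrite /both_even /both_odd /ev /od /=; lia.
by move=> [x y]; rewrite /both_even /both_odd /ev /od /=; lia.
Qed.

(** The map (x, y) -> (x + y, x - y) is conjugation followed by multiplication by 1 + i: it doubles
    the norm, and its image consists of the vectors with even coordinate sum. *)
Lemma rot45 (P Q : pred (int * int)) :
  (forall x y, P (x, y) -> ev (x + y)) ->
  (forall x y, Q (x, y) = P (x + y, x - y)) ->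
  gf P nrm = dil 2 (gf Q nrm).
Proof.
move=> Pev QP; rewrite dil_gf //; apply: (@gf_bij _ _ _ _ _ _
  (fun z => ((z.1 + z.2) %/ 2, (z.1 - z.2) %/ 2)%Z)
  (fun z => (z.1 + z.2, z.1 - z.2))).
  move=> [x y] Pxy; have := Pev _ _ Pxy; rewrite /ev /= => exy.
  set u := ((x + y) %/ 2)%Z; set v := ((x - y) %/ 2)%Z.
  have ex : x = u + v by lia.
  have ey : y = u - v by lia.
  rewrite QP -ex -ey; split => //.
  by apply/eqP; rewrite -eqz_nat PoszM !nrmE /= ex ey; apply/eqP; ring.
move=> [x y] Qxy; rewrite /= -QP; split=> //; congr pair; lia.
Qed.

Lemma th0_sqr : th0 * th0 = dil 2 (th0 * th0 + th1 * th1).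
Proof.
rewrite th0011 th00; apply: rot45 => x y; rewrite /both_even /ev /=; lia.
Qed.

Lemma th1_sqr : th1 * th1 = dil 2 (2 * (th0 * th1)).
Proof.
rewrite th11 th01; apply: rot45 => x y; rewrite /both_odd /odd_sum /ev /od /=; lia.
Qed.

(* The residue of z.1 + i z.2 modulo 2 + i, where i = -2. *)
Definition res k (z : int * int) : bool := (5 %| z.1 - 2 * z.2 - k)%Z.
Definition gfres (P : pred (int * int)) k : fps := gf (fun z => P z && res k z) nrm.

(* [Prot] and [Ppi] are invariance under multiplication by i and by 2 + i. *)
Section Gauss.
Variable P : pred (int * int).
Hypotheses (Prot : forall x y, P (x, y) = P (- y, x))
  (Ppi : forall x y, P (x, y) = P (2 * x - y, x + 2 * y)).

(** Multiplication by i preserves the norm and multiplies residues by -2, that is by 3 modulo 5. *)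
Lemma gfres_rot k l : (5 %| 3 * k - l)%Z -> gfres P k = gfres P l.
Proof.
move=> kl; apply: (@gf_bij _ _ _ _ _ _
  (fun z => (- z.2, z.1)) (fun z => (z.2, - z.1))).
  move=> [x y] /andP[Pz kz]; rewrite /= opprK -Prot Pz; split=> //.
    by move: kz; rewrite /res /=; lia.
  by apply/eqP; rewrite -eqz_nat !nrmE /=; apply/eqP; ring.
move=> [x y] /andP[Pz kz]; rewrite /= opprK; split=> //.
by rewrite Prot opprK Pz; move: kz; rewrite /res /=; lia.
Qed.

(** Residue 0 means divisible by 2 + i, an element of norm 5. *)
Lemma gfres0 : gfres P 0 = dil 5 (gf P nrm).
Proof.
rewrite dil_gf //; apply: (@gf_bij _ _ _ _ _ _
  (fun z => ((2 * z.1 + z.2) %/ 5, (2 * z.2 - z.1) %/ 5)%Z)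
  (fun z => (2 * z.1 - z.2, z.1 + 2 * z.2))).
  move=> [x y]; rewrite /res /= => /andP[Pxy kxy].
  set u := (_ %/ 5)%Z; set v := (_ %/ 5)%Z.
  have ex : x = 2 * u - v by lia.
  have ey : y = u + 2 * v by lia.
  split; [by rewrite Ppi -ex -ey | | by rewrite -ex -ey].
  by apply/eqP; rewrite -eqz_nat PoszM !nrmE /= ex ey; apply/eqP; ring.
move=> [x y] Pxy; rewrite -Ppi Pxy /res /=; split; first by lia.
congr pair; lia.
Qed.

(** The powers of 3 run through all nonzero residues modulo 5, in the order 1, 3, 4, 2, so the four
    nonzero classes contribute equally. *)
Lemma gf_gfres : gf P nrm = dil 5 (gf P nrm) + 4 * gfres P 1.
Proof.
have e3 : gfres P 1 = gfres P 3 by exact: gfres_rot.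
have e4 : gfres P 3 = gfres P 4 by exact: gfres_rot.
have e2 : gfres P 4 = gfres P 2 by exact: gfres_rot.
transitivity (gfres P 0 + (gfres P 1 + (gfres P 2 + (gfres P 3 + gfres P 4))));
  last first.
  by rewrite gfres0 e3 e4 e2; ring.
rewrite /gfres !gfD; try exact: locfin_nrm;
  try by move=> [x y]; rewrite /res /=; lia.
by apply: eq_gf => // -[x y]; case: (P _) => //=; rewrite /res /=; lia.
Qed.

End Gauss.

(** * Pairs of Gaussian integers and the four-dimensional bijection *)

Definition nrm2 (z : (int * int) * (int * int)) : nat := nrm z.1 + nrm z.2.

Lemma locfin_nrm2 (P : pred ((int * int) * (int * int))) : locfin P nrm2.
Proof.
apply: (@locfin_sub _ _ (fun z => predT z.1 && predT z.2)) => //.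
by apply: locfin_prod; exact: locfin_nrm.
Qed.

(* glue k holds at (a, b) when a + i^k b is divisible by (1+i)^3 = -2+2i. *)
Definition glue k (z : (int * int) * (int * int)) : bool :=
  let: ((a, a'), (b, b')) := z in
  let: (u, v) := match k with 0 => (a + b, a' + b') | 1 => (a - b', a' + b)
    | 2 => (a - b, a' - b') | _ => (a + b', a' - b) end in
  [&& odd_sum (a, a'), res 3 (a, a'), odd_sum (b, b'), res 0 (b, b'),
      ev u & (4 %| u + v)%Z].

(** Replacing b by ib turns a + i^k b into a + i^(k+1) b, and keeps the norm and residue 0. *)
Lemma glue_rot k : (k < 3)%N -> gf (glue k.+1) nrm2 = gf (glue k) nrm2.
Proof.
move=> k3; apply: (@gf_bij _ _ _ _ _ _
  (fun z => (z.1, (- z.2.2, z.2.1))) (fun z => (z.1, (z.2.2, - z.2.1)))).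
  move=> [[a a'] [b b']] Rz; rewrite /= opprK; split=> //.
    by case: k k3 Rz => [|[|[|]]] // _; rewrite /glue /odd_sum /res /ev /od /=; lia.
  by apply/eqP; rewrite -eqz_nat !PoszD !sqE /=; apply/eqP; ring.
move=> [[a a'] [b b']] Rz; rewrite /= opprK; split=> //.
by case: k k3 Rz => [|[|[|]]] // _; rewrite /glue /odd_sum /res /ev /od /=; lia.
Qed.

(** Elements of odd norm are units modulo (1+i)^3, and these units are exactly the four powers of i;
    hence exactly one [k < 4] makes a + i^k b divisible. The Booleans [e], [c], [d] encode this
    choice, so that disjointness and exhaustion become propositional. *)
Lemma glue_cases z : exists e c d : bool,
  [/\ glue 0 z = [&& odd_sum z.1, res 3 z.1, odd_sum z.2, res 0 z.2, e & c],
      glue 1 z = [&& odd_sum z.1, res 3 z.1, odd_sum z.2, res 0 z.2, ~~ e & d],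
      glue 2 z = [&& odd_sum z.1, res 3 z.1, odd_sum z.2, res 0 z.2, e & ~~ c]
    & glue 3 z
      = [&& odd_sum z.1, res 3 z.1, odd_sum z.2, res 0 z.2, ~~ e & ~~ d]].
Proof.
case: z => -[a a'] [b b'].
exists (ev (a + b)), (4 %| a + b + (a' + b'))%Z, (4 %| a - b' + (a' + b))%Z.
rewrite /glue /=; case: (boolP (odd_sum (a, a'))) => //= odd_a.
case: (res 3 _) => //=; case: (boolP (odd_sum (b, b'))) => //= odd_b.
case: (res 0 _) => //=; rewrite /odd_sum /od /= in odd_a odd_b.
have -> : ev (a - b') = ~~ ev (a + b) by rewrite /ev; lia.
have -> : ev (a - b) = ev (a + b) by rewrite /ev; lia.
have -> : ev (a + b') = ~~ ev (a + b) by rewrite /ev; lia.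
have -> : (4 %| a - b + (a' - b'))%Z = ~~ (4 %| a + b + (a' + b'))%Z by lia.
have -> : (4 %| a + b' + (a' - b))%Z = ~~ (4 %| a - b' + (a' + b))%Z by lia.
by [].
Qed.

Lemma glue_split : gfres odd_sum 3 * gfres odd_sum 0 = 4 * gf (glue 0) nrm2.
Proof.
rewrite /gfres gfM; try exact: locfin_nrm.
transitivity (gf (glue 0) nrm2
  + (gf (glue 1) nrm2 + (gf (glue 2) nrm2 + gf (glue 3) nrm2))).
  rewrite !gfD; try exact: locfin_nrm2;
    try (move=> z; have [e [c [d [g0 g1 g2 g3]]]] := glue_cases z;
      rewrite ?(g0, g1, g2, g3); move: e c d {g0 g1 g2 g3};
      by move: (odd_sum z.1) (res 3 z.1) (odd_sum z.2) (res 0 z.2)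
        => [] [] [] [] [] [] []).
  apply: eq_gf => // z; have [e [c [d [-> -> -> ->]]]] := glue_cases z.
  by move: (odd_sum z.1) (res 3 z.1) (odd_sum z.2) (res 0 z.2) e c d
    => [] [] [] [] [] [] [].
by rewrite !glue_rot //; ring.
Qed.

(** The map is (z, z') -> (a, b) = ((z + z')/(1+i), (z - z')/(1+i)), which preserves the total norm.
    As 1 + i is -1 modulo 2 + i, residues (1, 1) become (-2, 0), that is (3, 0). Since a + b =
    2z/(1+i), evenness of z says that (1+i)^3 divides a + b. *)
Lemma glue0 : gfres both_even 1 * gfres both_odd 1 = gf (glue 0) nrm2.
Proof.
rewrite /gfres gfM; try exact: locfin_nrm.
apply: (@gf_bij _ _ _ _ _ _
  (fun z : (int * int) * (int * int) => let: ((x, y), (x', y')) := z in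
     (((x + x' + y + y') %/ 2, (y + y' - x - x') %/ 2)%Z,
      ((x - x' + y - y') %/ 2, (y - y' - x + x') %/ 2)%Z))
  (fun z : (int * int) * (int * int) => let: ((a, a'), (b, b')) := z in
     (((a + b - a' - b') %/ 2, (a + b + a' + b') %/ 2)%Z,
      ((a - b - a' + b') %/ 2, (a - b + a' - b') %/ 2)%Z))).
  move=> [[x y] [x' y']]; rewrite /both_even /both_odd /res /ev /od /= => H.
  set a := (_ %/ 2)%Z; set a' := (_ %/ 2)%Z.
  set b := (_ %/ 2)%Z; set b' := (_ %/ 2)%Z.
  have ex : 2 * x = a + b - a' - b' by lia.
  have ey : 2 * y = a + b + a' + b' by lia.
  have ex' : 2 * x' = a - b - a' + b' by lia.
  have ey' : 2 * y' = a - b + a' - b' by lia.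
  split.
  - by rewrite /glue /odd_sum /res /od /ev /=; lia.
  - apply/eqP; rewrite -eqz_nat !PoszD !sqE /=; apply/eqP.
    apply: (@mulfI _ 4) => //.
    transitivity ((2 * x) ^+ 2 + (2 * y) ^+ 2 + (2 * x') ^+ 2 + (2 * y') ^+ 2).
      by rewrite ex ey ex' ey'; ring.
    by ring.
  - by rewrite -ex -ey -ex' -ey' !mulKz.
move=> [[a a'] [b b']].
rewrite /glue /both_even /both_odd /res /odd_sum /ev /od /= => H.
split; first by lia.
congr (pair (pair _ _) (pair _ _)); lia.
Qed.

Local Notation D5 := (dil 5).
Local Notation X := fpsX.

(** Both sides equal 16 times the series of [glue 0]: the left one through [glue0], the right one
    through [glue_split]. *)
Lemma theta_parity_rel : (th0 ^+ 2 - D5 th0 ^+ 2) * (th1 ^+ 2 - D5 th1 ^+ 2)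
  = 4 * (th0 * th1 - D5 th0 * D5 th1) * (D5 th0 * D5 th1).
Proof.
have rot P : (forall x y, P (x, y) = P (- y, x)) ->
    (forall x y, P (x, y) = P (2 * x - y, x + 2 * y)) ->
    gf P nrm - D5 (gf P nrm) = 4 * gfres P 1.
  by move=> Prot Ppi; rewrite {1}(gf_gfres Prot Ppi) addrC addKr.
have eE : th0 ^+ 2 - D5 th0 ^+ 2 = 4 * gfres both_even 1.
  by rewrite -[D5 _ ^+ 2]rmorphM -expr2 expr2 th00; apply: rot => x y;
    rewrite /both_even /ev /=; lia.
have eO : th1 ^+ 2 - D5 th1 ^+ 2 = 4 * gfres both_odd 1.
  by rewrite -[D5 _ ^+ 2]rmorphM -expr2 expr2 th11; apply: rot => x y;
    rewrite /both_odd /od /=; lia.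
have Mrot x y : odd_sum (x, y) = odd_sum (- y, x).
  by rewrite /odd_sum /od /=; lia.
have Mpi x y : odd_sum (x, y) = odd_sum (2 * x - y, x + 2 * y).
  by rewrite /odd_sum /od /=; lia.
have eM0 : 2 * (D5 th0 * D5 th1) = gfres odd_sum 0.
  by rewrite gfres0 // -th01 !rmorphM rmorph_nat.
have eM : 2 * (th0 * th1 - D5 th0 * D5 th1) = 4 * gfres odd_sum 1.
  by rewrite mulrBr eM0 gfres0 // th01 rot.
have e13 : gfres odd_sum 1 = gfres odd_sum 3 by exact: gfres_rot.
transitivity (4 * (4 * (gfres both_even 1 * gfres both_odd 1))).
  by rewrite eE eO; ring.
rewrite glue0 -glue_split -e13 -eM0.
transitivity (4 * gfres odd_sum 1 * (2 * (D5 th0 * D5 th1))); first by ring.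
by rewrite -eM; ring.
Qed.

(** * The signed theta series and the classical identities between phi and psi *)

Lemma gf_seq (T : choiceType) (P : pred T) e n (r : seq T) : uniq r ->
  (forall x, P x -> e x = n -> x \in r) ->
  gf P e n = \sum_(x <- r | P x && (e x == n)) 1.
Proof.
move=> r_uniq Pr; rewrite [RHS]bigfs // => x /andP[Px /eqP ex] /negP[].
exact: Pr.
Qed.

Lemma phi_negE : phi_neg = flip phi.
Proof.
apply: fpsP => m.
pose r : seq int := [seq i%:Z - m%:Z | i <- index_iota 0 (2 * m).+1].
rewrite /flip /phi (@gf_seq _ _ _ _ r) => [| | x _ xm].
- rewrite big_map /phi_neg mulr_sumr big_mkord.
  apply: eq_big => [i | i /eqP im]; first by rewrite -eqz_nat sqE expr2.
  (* The summation index [i - m] has square [m], hence the parity of [m], so its sign is (-1)^m. *)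
  have [j ->] : exists j : int, i%:Z - m%:Z = m%:Z + 2 * j.
    move: im; set d := i%:Z - m%:Z; rewrite expr2 => <-.
    have [k [->|->]] : exists k, d = 2 * k \/ d = 2 * k + 1.
      by exists (d %/ 2)%Z; lia.
    - by exists (k - 2 * k * k); ring.
    - by exists (- k - 2 * k * k); ring.
  by rewrite exprzDr // -exprz_exp (_ : (-1) ^ 2 = 1 :> int) // exp1rz mulr1.
- by rewrite map_inj_uniq ?iota_uniq // => i j; lia.
- apply/mapP; exists (absz (x + m%:Z)); have := sqE x; rewrite ?mem_index_iota; nia.
Qed.

Lemma psi_negE : psi_neg = flip psi.
Proof.
apply: fpsP => m.
rewrite /flip /psi (@gf_seq _ _ _ _ (index_iota 0 m.+1)) ?iota_uniq //.
  rewrite /psi_neg mulr_sumr big_mkord.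
  by apply: eq_bigr => i /eqP->; rewrite mulr1.
by move=> k _ km; rewrite mem_index_iota; nia.
Qed.

Lemma flip_dil k f : (0 < k)%N ->
  flip (dil k f) = dil k (if odd k then flip f else f).
Proof.
move=> k0; apply: fpsP => n; rewrite /flip.
have [/dvdnP[m ->{n}] | ndv] := boolP (k %| n)%N; last first.
  by rewrite !coef_dilN ?mulr0.
rewrite mulnC !coef_dil //; case: ifP => odd_k.
  by rewrite -signr_odd oddM odd_k signr_odd.
by rewrite -signr_odd oddM odd_k mul1r.
Qed.

Lemma flipX : flip X = - X.
Proof. by apply: fpsP => -[|[|n]]; rewrite fcoefN /flip /= ?mulr0. Qed.

Lemma flipK : involutive flip.
Proof.
by move=> f; apply: fpsP => n; rewrite /flip mulrA -expr2 sqrr_sign mul1r.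
Qed.

Definition psi2 : fps := dil 2 psi.
Definition phim : fps := flip phi.

Lemma X_neq0 : X != 0 :> fps.
Proof. by apply/eqP => /(congr1 (fun f : fps => f 1%N)). Qed.

Lemma nat_neq0 k : (0 < k)%N -> k%:R != 0 :> fps.
Proof.
move=> k0; apply/eqP => /(congr1 (fun f : fps => f 0%N)).
rewrite -[k%:R]mulr1 fcoef_natM mulr1 fcoef0 => /eqP.
by rewrite pnatr_eq0 eqn0Ngt k0.
Qed.

(** This is [th1_sqr] written with psi(q^8), phi(q^8) and psi(q^16), after cancelling 4 q^2 and
    undoing q -> q^8. *)
Lemma psi_sqr : psi ^+ 2 = phi * psi2.
Proof.
have e : (2 * X * dil 8 psi) ^+ 2 = 4 * X ^+ 2 * (dil 8 phi * dil 8 psi2).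
  rewrite -th1_dil expr2 th1_sqr th1_dil th0_dil !rmorphM !rmorph_nat /=.
  rewrite -{1}[X]expr1 dilX // /psi2.
  rewrite !(@dil_dil 2 4 8, @dil_dil 2 8 16, @dil_dil 8 2 16) //.
  by ring.
apply: (@dil_inj 8) => //; rewrite rmorphXn [RHS]rmorphM /=.
have n0 : 4 * X ^+ 2 != 0 by rewrite mulf_neq0 ?expf_neq0 ?X_neq0 ?nat_neq0.
by apply: (mulfI n0); rewrite -e; ring.
Qed.

Lemma phim_split : phim = th0 - th1.
Proof.
rewrite /phim phi_split rmorphD /= th1_dil th0_dil flip_dil //=.
rewrite !rmorphM !rmorph_nat /=.
by rewrite flipX flip_dil //=; ring.
Qed.

(** With phi = [th0 + th1] and phi(-q) = [th0 - th1], the difference of fourth powers is 8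
    [th0 * th1] ([th0 ^+ 2 + th1 ^+ 2]); each factor is then a theta product. *)
Lemma phi4 : phi ^+ 4 - phim ^+ 4 = 16 * X * psi2 ^+ 4.
Proof.
have e1 : th0 ^+ 2 + th1 ^+ 2 = dil 2 phi ^+ 2.
  rewrite !expr2 -[RHS]rmorphM phi_split.
  transitivity (dil 2 (th0 * th0 + th1 * th1 + 2 * (th0 * th1))).
    by rewrite [RHS]rmorphD /= -th0_sqr -th1_sqr.
  by congr (dil 2 _); ring.
have e2 : th0 * th1 = 2 * X * dil 4 psi ^+ 2.
  rewrite -rmorphXn psi_sqr rmorphM /= th0_dil th1_dil /psi2.
  by rewrite (@dil_dil 4 2 8) //; ring.
have e3 : dil 4 psi * dil 2 phi = psi2 ^+ 2.
  by rewrite -[psi2 ^+ 2]rmorphXn psi_sqr rmorphM /= /psi2 (@dil_dil 2 2 4) //; ring.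
rewrite phim_split phi_split.
transitivity (8 * (th0 * th1) * (th0 ^+ 2 + th1 ^+ 2)); first by ring.
by rewrite e1 e2 -[psi2 ^+ 4]/(psi2 ^+ (2 * 2)) exprM -e3; ring.
Qed.

(** This is [theta_parity_rel] with [th0] = phi(q^4) and [th1] = 2 q psi(q^8), after cancelling 4
    q^2 and undoing q -> q^4. *)
Lemma phi_psi2 : (phi ^+ 2 - D5 phi ^+ 2) * (psi2 ^+ 2 - X ^+ 2 * dil 10 psi ^+ 2)
   = 4 * X * (phi * psi2 - X * D5 phi * dil 10 psi) * (D5 phi * dil 10 psi).
Proof.
have := theta_parity_rel; rewrite th0_dil th1_dil => e.
have n0 : 4 * X ^+ 2 != 0 by rewrite mulf_neq0 ?expf_neq0 ?X_neq0 ?nat_neq0.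
apply: (@dil_inj 4) => //; apply: (mulfI n0).
have dX k : dil k.+1 X = X ^+ k.+1 by rewrite -[X]expr1 dilX // muln1.
move: e; rewrite !(rmorphB, rmorphM, rmorphXn, rmorph_nat) /= !dX.
rewrite /psi2 !(@dil_dil 5 4 20, @dil_dil 5 8 40, @dil_dil 4 2 8,
                @dil_dil 4 5 20, @dil_dil 4 10 40) // => e.
transitivity ((dil 4 phi ^+ 2 - dil 20 phi ^+ 2) *
   ((2 * X * dil 8 psi) ^+ 2 - (2 * X ^+ 5 * dil 40 psi) ^+ 2)); first by ring.
by rewrite e; ring.
Qed.

(** * Algebra of the level-5 relations *)

(* Here f, F, c, C stand for phi(q), phi(q^5), psi(q^2), psi(q^10), and p, P
   for phi(-q), phi(-q^5); a, A stand for psi(q), psi(q^5). *)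
Definition phi_psi2_rel (R : comNzRingType) (q f F c C : R) : Prop :=
  (f ^+ 2 - F ^+ 2) * (c ^+ 2 - q ^+ 2 * C ^+ 2)
    = 4 * q * (f * c - q * F * C) * (F * C).

Definition theta_rel (R : comNzRingType) (q f F p P c C : R) : Prop :=
  [/\ phi_psi2_rel q f F c C, phi_psi2_rel (- q) p P c C,
      f ^+ 4 - p ^+ 4 = 16 * q * c ^+ 4
    & F ^+ 4 - P ^+ 4 = 16 * q ^+ 5 * C ^+ 4].

(** Up to nonzero factors, these are [l + n], [1 - 5 m^2], [n^4 - m^4] and [1 - m^2] in the
    coordinates of the curve below. *)
Definition theta_nondeg (R : comNzRingType) (q f F p P c C : R) : Prop :=
  [/\ F * p + P * f != 0, c ^+ 2 - 5 * q ^+ 2 * C ^+ 2 != 0,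
      (P * c) ^+ 4 - (q * C * p) ^+ 4 != 0 & c ^+ 2 - q ^+ 2 * C ^+ 2 != 0].

(** The last clause makes the product [a * A] a rational function of the other series. *)
Definition psi_rel (R : comNzRingType) (q f F c C a A : R) : Prop :=
  [/\ a ^+ 2 = f * c, A ^+ 2 = F * C
    & 4 * q * a * A * (c ^+ 2 - q ^+ 2 * C ^+ 2)
        = F * c * (f ^+ 2 - F ^+ 2)].

(** The difference to be proved even in q; the coefficient -19 is 1 - 20. *)
Definition psi_comb (R : comUnitRingType) (q f F a A : R) : R :=
  a ^+ 5 / A - q * a ^+ 3 * A + 7 * q ^+ 2 * a * A ^+ 3
    - 19 * q ^+ 3 * A ^+ 5 / a - 2 * f * F ^+ 3.

(* With l = F / f, n = P / p and m = q C / c, both l and - n are roots of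
   the quadratic equation expressed by [hl]; since l <> - n they are its two
   roots, so everything lives on the curve s^2 = 1 - 2 m^2 + 5 m^4. *)
Section Curve.
Variables (K : fieldType) (l n m y : K).
Hypotheses (hl : (1 - l ^+ 2) * (1 - m ^+ 2) = 4 * l * m * (1 - l * m))
  (hn : (1 - n ^+ 2) * (1 - m ^+ 2) = - (4 * n * m * (1 + n * m)))
  (ln : l + n != 0) (g0 : 1 - 5 * m ^+ 2 != 0)
  (nm0 : n ^+ 4 - m ^+ 4 != 0) (m0 : m != 0) (m1 : 1 - m ^+ 2 != 0)
  (hy : y * (n ^+ 4 - m ^+ 4) = l ^+ 4 - m ^+ 4).

Lemma curve_param : exists s, [/\ s ^+ 2 = 1 - 2 * m ^+ 2 + 5 * m ^+ 4,
   l = (s - 2 * m) / (1 - 5 * m ^+ 2) & n = (s + 2 * m) / (1 - 5 * m ^+ 2)].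
Proof.
(* Completing the square in (1 - 5m^2) l^2 + 4m l - (1 - m^2) = 0. *)
exists (l * (1 - 5 * m ^+ 2) + 2 * m); split.
- apply/eqP; rewrite -subr_eq0; apply/eqP.
  transitivity ((1 - 5 * m ^+ 2) *
    (4 * l * m * (1 - l * m) - (1 - l ^+ 2) * (1 - m ^+ 2))); first by ring.
  by rewrite hl subrr mulr0.
- by rewrite addrK mulfK.
- apply: (mulIf g0); rewrite divfK //.
  (* The difference of the equations for [l] and [- n] has the factor [l + n]. *)
  apply/eqP; rewrite -subr_eq0; apply/eqP; apply: (mulfI ln); rewrite mulr0.
  transitivity ((1 - l ^+ 2) * (1 - m ^+ 2) - 4 * l * m * (1 - l * m)
   - ((1 - n ^+ 2) * (1 - m ^+ 2) + (4 * n * m * (1 + n * m)))); first by ring.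
  by rewrite hl hn; ring.
Qed.

(** In the application [y] is (phi(-q)/phi(q))^4. Once [hy] has eliminated it, the claim is a
    polynomial identity modulo the equation of the curve. *)
Lemma curve_y : (1 - y) * (m * (1 - m ^+ 2) ^+ 2) = l * (1 - l ^+ 2) ^+ 2.
Proof.
apply: (mulIf nm0); transitivity
  ((n ^+ 4 - m ^+ 4 - y * (n ^+ 4 - m ^+ 4)) * (m * (1 - m ^+ 2) ^+ 2)).
  by ring.
by rewrite hy; have [s [hs -> ->]] := curve_param; field: hs.
Qed.

Let yE : y = 1 - l * (1 - l ^+ 2) ^+ 2 / (m * (1 - m ^+ 2) ^+ 2).
Proof. by rewrite -curve_y mulfK ?mulf_neq0 ?expf_neq0 //; ring. Qed.

Lemma curve_even :
  8 * m * (l ^+ 5 + y * n ^+ 5)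
  = (1 - y) * (1 - m ^+ 2 + 7 * m ^+ 4 + m ^+ 6).
Proof.
by rewrite yE; have [s [hs -> ->]] := curve_param; field: hs; rewrite m1 m0 g0.
Qed.

(** The bracket on the right is the left-hand side under l -> n, m -> -m, the effect of q -> -q; the
    weight [y] comes from normalizing by [f ^+ 4] instead of [p ^+ 4]. *)
Lemma curve_odd :
  (1 - l ^+ 2) * (1 - l * m + 7 * l ^+ 2 * m ^+ 2 - 19 * l ^+ 3 * m ^+ 3)
    - 8 * l ^+ 3 * m * (1 - m ^+ 2)
  = - y * ((1 - n ^+ 2)
             * (1 + n * m + 7 * n ^+ 2 * m ^+ 2 + 19 * n ^+ 3 * m ^+ 3)
           + 8 * n ^+ 3 * m * (1 - m ^+ 2)).
Proof.
by rewrite yE; have [s [hs -> ->]] := curve_param; field: hs; rewrite m1 m0 g0.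
Qed.

End Curve.

(** * From the curve back to theta quotients, over a field *)

Section ThetaField.
Variables (K : fieldType) (q f F p P c C : K).
Hypotheses (two0 : 2 != 0 :> K) (q0 : q != 0) (f0 : f != 0) (F0 : F != 0)
  (p0 : p != 0) (P0 : P != 0) (c0 : c != 0) (C0 : C != 0).
Hypotheses (rel : theta_rel q f F p P c C) (nd : theta_nondeg q f F p P c C).

Let nz := (f0, F0, p0, P0, c0, C0, q0).
Let l := F / f.
Let n := P / p.
Let m := q * C / c.
Let y := p ^+ 4 / f ^+ 4.

Let hl : (1 - l ^+ 2) * (1 - m ^+ 2) = 4 * l * m * (1 - l * m).
Proof.
have [hf _ _ _] := rel.
transitivity ((f ^+ 2 - F ^+ 2) * (c ^+ 2 - q ^+ 2 * C ^+ 2) / (f * c) ^+ 2).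
  by rewrite /l /m; field; rewrite ?nz.
by rewrite hf /l /m; field; rewrite ?nz.
Qed.

Let hn : (1 - n ^+ 2) * (1 - m ^+ 2) = - (4 * n * m * (1 + n * m)).
Proof.
have [_ hp _ _] := rel.
transitivity ((p ^+ 2 - P ^+ 2) * (c ^+ 2 - (- q) ^+ 2 * C ^+ 2) / (p * c) ^+ 2).
  by rewrite /n /m; field; rewrite ?nz.
by rewrite hp /n /m; field; rewrite ?nz.
Qed.

Let ln : l + n != 0.
Proof.
by have [n1 _ _ _] := nd; rewrite addf_div // mulf_neq0 ?invr_neq0 ?mulf_neq0.
Qed.

Let g0 : 1 - 5 * m ^+ 2 != 0.
Proof.
have [_ n2 _ _] := nd.
have -> : 1 - 5 * m ^+ 2 = (c ^+ 2 - 5 * q ^+ 2 * C ^+ 2) / c ^+ 2.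
  by rewrite /m; field.
by rewrite mulf_neq0 ?invr_neq0 ?expf_neq0.
Qed.

Let m1 : 1 - m ^+ 2 != 0.
Proof.
have [_ _ _ n4] := nd.
have -> : 1 - m ^+ 2 = (c ^+ 2 - q ^+ 2 * C ^+ 2) / c ^+ 2 by rewrite /m; field.
by rewrite mulf_neq0 ?invr_neq0 ?expf_neq0.
Qed.

Let nm0 : n ^+ 4 - m ^+ 4 != 0.
Proof.
have [_ _ n3 _] := nd.
have -> : n ^+ 4 - m ^+ 4 = ((P * c) ^+ 4 - (q * C * p) ^+ 4) / (p * c) ^+ 4.
  by rewrite /n /m; field; rewrite ?nz.
by rewrite mulf_neq0 ?invr_neq0 ?expf_neq0 ?mulf_neq0.
Qed.

Let m0 : m != 0.
Proof. by rewrite mulf_neq0 ?invr_neq0 ?mulf_neq0. Qed.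

Let hz : 1 - y = 16 * q * c ^+ 4 / f ^+ 4.
Proof. by have [_ _ <- _] := rel; rewrite /y; field. Qed.

Let hy : y * (n ^+ 4 - m ^+ 4) = l ^+ 4 - m ^+ 4.
Proof.
have [_ _ _ hC] := rel.
have -> : l ^+ 4 = (F ^+ 4 - P ^+ 4 + P ^+ 4) / f ^+ 4.
  by rewrite subrK expr_div_n.
transitivity (y * n ^+ 4 + (1 - y) * m ^+ 4 - m ^+ 4); first by ring.
by rewrite hz hC /y /n /m; field; rewrite ?nz.
Qed.

(** This is [curve_y] with denominators cleared; it yields the square of the last clause of
    [psi_rel]. *)
Lemma psi_mul_sqr_field :
  16 * q ^+ 2 * f * C * (c ^+ 2 - q ^+ 2 * C ^+ 2) ^+ 2
  = F * c * (f ^+ 2 - F ^+ 2) ^+ 2.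
Proof.
have := curve_y hl hn ln g0 nm0 hy; rewrite hz => e.
transitivity
  (f ^+ 5 * c * (16 * q * c ^+ 4 / f ^+ 4 * (m * (1 - m ^+ 2) ^+ 2))).
  by rewrite /m; field; rewrite ?nz.
by rewrite e /l; field; rewrite ?nz.
Qed.

Lemma phi_quot_add_field :
  P ^+ 5 / p + F ^+ 5 / f
  = 2 * c ^+ 5 / C - 2 * q ^+ 2 * c ^+ 3 * C + 14 * q ^+ 4 * c * C ^+ 3
    + 2 * q ^+ 6 * C ^+ 5 / c.
Proof.
(* This factor turns the claim into [curve_even], with [1 - y] rewritten by [hz]. *)
have n8 : 8 * m / f ^+ 4 != 0.
  by rewrite !mulf_neq0 ?invr_neq0 ?expf_neq0 // (natrX _ 2 3) expf_neq0.
apply: (mulfI n8); transitivity (8 * m * (l ^+ 5 + y * n ^+ 5)).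
  by rewrite /l /y /n; field; rewrite ?nz.
rewrite (curve_even hl hn ln g0 nm0 m0 m1 hy) hz /m.
by field; rewrite ?nz.
Qed.

Variables (a A b B : K).
Hypotheses (a0 : a != 0) (A0 : A != 0) (b0 : b != 0) (B0 : B != 0)
  (relA : psi_rel q f F c C a A) (relB : psi_rel (- q) p P c C b B).

Lemma psi_comb_field : psi_comb q f F a A = psi_comb (- q) p P b B.
Proof.
have [_ _ _ n4] := nd.
have n40 : 4 != 0 :> K by rewrite (natrX _ 2 2) expf_neq0.
have n4' r : r ^+ 2 = q ^+ 2 -> r != 0 ->
    4 * r * (c ^+ 2 - r ^+ 2 * C ^+ 2) != 0.
  by move=> -> r0; rewrite !mulf_neq0.
(* Every psi term of [psi_comb] is [u * U] times a rational function of [u ^+ 2] and [U ^+ 2], so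
   [psi_rel] eliminates [u] and [U]. Assuming only [r ^+ 2 = q ^+ 2] covers both signs of q. *)
have E (r v V u U : K) : r ^+ 2 = q ^+ 2 -> r != 0 ->
    u != 0 -> U != 0 -> v != 0 -> V != 0 -> psi_rel r v V c C u U ->
    psi_comb r v V u U
    = V * c * (v ^+ 2 - V ^+ 2) / (4 * r * (c ^+ 2 - r ^+ 2 * C ^+ 2))
      * (v ^+ 2 * c ^+ 2 / (V * C) - r * (v * c) + 7 * r ^+ 2 * (V * C)
        - 19 * r ^+ 3 * (V ^+ 2 * C ^+ 2) / (v * c)) - 2 * v * V ^+ 3.
  move=> r2 r0 u0 U0 v0 V0 [hu hU huU].
  have -> : V * c * (v ^+ 2 - V ^+ 2) / (4 * r * (c ^+ 2 - r ^+ 2 * C ^+ 2))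
      = u * U.
    by apply: (mulIf (n4' r r2 r0)); rewrite divfK ?n4' // -huU; ring.
  by rewrite /psi_comb -!exprMn -hu -hU; field; rewrite ?u0 ?U0.
have d0 : 4 * m * (1 - m ^+ 2) / f ^+ 4 != 0.
  by rewrite !mulf_neq0 ?invr_neq0 ?expf_neq0.
rewrite (E _ _ _ _ _ _ _ _ _ _ _ relA) ?(E _ _ _ _ _ _ _ _ _ _ _ relB) //;
  rewrite ?sqrrN ?oppr_eq0 //.
apply: (mulfI d0); transitivity
  ((1 - l ^+ 2) * (1 - l * m + 7 * l ^+ 2 * m ^+ 2 - 19 * l ^+ 3 * m ^+ 3)
    - 8 * l ^+ 3 * m * (1 - m ^+ 2)).
  by rewrite /l /m; field; rewrite ?nz ?exprMn ?n4 ?n40.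
rewrite (curve_odd hl hn ln g0 nm0 m0 m1 hy) /m /n /y.
by field; rewrite ?oppr_eq0 ?nz ?exprMn ?n4 ?n40.
Qed.

End ThetaField.

(** * Transfer to an integral domain through its fraction field *)

Section ThetaDomain.
Variables (R : idomainType) (q f F p P c C : R).
Hypotheses (two0 : 2 != 0 :> R) (q0 : q != 0) (fU : f \is a GRing.unit)
  (FU : F \is a GRing.unit) (pU : p \is a GRing.unit) (PU : P \is a GRing.unit)
  (cU : c \is a GRing.unit) (CU : C \is a GRing.unit).
Hypotheses (rel : theta_rel q f F p P c C) (nd : theta_nondeg q f F p P c C).

Local Notation tf := (@FracField.tofrac R).

Let tf_neq0 (x : R) : x != 0 -> tf x != 0.
Proof. by rewrite tofrac_eq0. Qed.

Let tfU_neq0 (x : R) : x \is a GRing.unit -> tf x != 0.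
Proof.
by move=> xU; apply/tf_neq0; apply: contraTneq xU => ->; rewrite unitr0.
Qed.

Let tf_inj : injective tf.
Proof. by move=> x y /eqP; rewrite tofrac_eq => /eqP. Qed.

Let tf_nat k : tf k%:R = k%:R.
Proof. exact: rmorph_nat. Qed.

Let tfE := (tf_nat, @tofracB R, @tofracN R, @tofracD R, @tofracXn R, @tofracM R).

Let tf2 : 2 != 0 :> {fraction R}.
Proof. by rewrite -(tf_nat 2) tf_neq0. Qed.

Let tf_rel : theta_rel (tf q) (tf f) (tf F) (tf p) (tf P) (tf c) (tf C).
Proof.
case: rel => /(congr1 tf) h1 /(congr1 tf) h2 /(congr1 tf) h3 /(congr1 tf) h4.
by rewrite !tfE in h1 h2 h3 h4.
Qed.

Let tf_nd : theta_nondeg (tf q) (tf f) (tf F) (tf p) (tf P) (tf c) (tf C).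
Proof.
by case: nd => /tf_neq0 h1 /tf_neq0 h2 /tf_neq0 h3 /tf_neq0 h4;
  rewrite !tfE in h1 h2 h3 h4.
Qed.

Lemma psi_mul_sqr :
  16 * q ^+ 2 * f * C * (c ^+ 2 - q ^+ 2 * C ^+ 2) ^+ 2
  = F * c * (f ^+ 2 - F ^+ 2) ^+ 2.
Proof.
apply: tf_inj; rewrite !tfE.
by apply: (psi_mul_sqr_field _ _ _ tf_rel tf_nd); rewrite tfU_neq0.
Qed.

Lemma phi_quot_add :
  P ^+ 5 / p + F ^+ 5 / f
  = 2 * c ^+ 5 / C - 2 * q ^+ 2 * c ^+ 3 * C + 14 * q ^+ 4 * c * C ^+ 3
    + 2 * q ^+ 6 * C ^+ 5 / c.
Proof.
apply: tf_inj; rewrite !tfE !rmorphV //.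
by apply: (phi_quot_add_field tf2 (tf_neq0 q0) _ _ _ _ tf_rel tf_nd);
  rewrite tfU_neq0.
Qed.

Variables (a A b B : R).
Hypotheses (aU : a \is a GRing.unit) (AU : A \is a GRing.unit)
  (bU : b \is a GRing.unit) (BU : B \is a GRing.unit)
  (relA : psi_rel q f F c C a A) (relB : psi_rel (- q) p P c C b B).

Let tf_psi_rel r v V u U : psi_rel r v V c C u U ->
  psi_rel (tf r) (tf v) (tf V) (tf c) (tf C) (tf u) (tf U).
Proof.
case=> /(congr1 tf) h1 /(congr1 tf) h2 /(congr1 tf) h3.
by rewrite !tfE in h1 h2 h3.
Qed.

Let tf_psi_comb r v V u U : u \is a GRing.unit -> U \is a GRing.unit ->
  tf (psi_comb r v V u U) = psi_comb (tf r) (tf v) (tf V) (tf u) (tf U).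
Proof. by move=> uU UU; rewrite !tfE !rmorphV. Qed.

Lemma psi_comb_opp : psi_comb q f F a A = psi_comb (- q) p P b B.
Proof.
have relB' := tf_psi_rel relB; rewrite tofracN in relB'.
apply: tf_inj; rewrite !tf_psi_comb // tofracN.
by apply: (psi_comb_field tf2 (tf_neq0 q0) _ _ _ _ _ _ tf_rel tf_nd _ _ _ _
  (tf_psi_rel relA) relB'); rewrite tfU_neq0.
Qed.

End ThetaDomain.

(** * The generating functions of abar5 and bbar5 *)

Local Notation phi5 := (dil 5 phi).
Local Notation phim5 := (dil 5 phim).
Local Notation psi5 := (dil 5 psi).
Local Notation psi10 := (dil 10 psi).
Local Notation psim := (flip psi).
Local Notation psim5 := (dil 5 (flip psi)).

Lemma flip_dil5 g : flip (dil 5 g) = dil 5 (flip g).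
Proof. exact: flip_dil. Qed.

Lemma flip_psi2 : flip psi2 = psi2.
Proof. exact: flip_dil. Qed.

Lemma flip_psi10 : flip psi10 = psi10.
Proof. exact: flip_dil. Qed.

Definition flipE := (flip_dil5, flip_psi2, flip_psi10, flipX).

Lemma coef0_dil k g : (0 < k)%N -> dil k g 0%N = g 0%N.
Proof. by move=> k0; rewrite -[RHS](coef_dil k0 g 0) muln0. Qed.

Lemma coef0_flip g : flip g 0%N = g 0%N.
Proof. by rewrite /flip mul1r. Qed.

Lemma coef0_phi : phi 0%N = 1.
Proof. by rewrite -coef0_flip -phi_negE phi_neg0. Qed.

Lemma coef0_psi : psi 0%N = 1.
Proof. by rewrite -coef0_flip -psi_negE psi_neg0. Qed.

Lemma coef1_phi : phi 1%N = 2.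
Proof.
have : flip phi 1%N = -2.
  by rewrite -phi_negE /phi_neg big_mkcond !big_ord_recl big_ord0.
by rewrite /flip expr1 mulN1r => /oppr_inj.
Qed.

Lemma coef0_phim : phim 0%N = 1.
Proof. by rewrite /phim coef0_flip coef0_phi. Qed.

Lemma coef0_psi2 : psi2 0%N = 1.
Proof. by rewrite /psi2 coef0_dil // coef0_psi. Qed.

Definition coefs := (coef0_phi, coef0_psi, coef0_phim, coef0_psi2, coef0_flip,
  coef0_dil, fcoef0M, fcoef0X, fcoefB, fcoefN, fcoefD).

Lemma neq0_coef0 (g : fps) : g 0%N != 0 -> g != 0.
Proof. by apply: contra_neq => ->. Qed.

Lemma unit_coef0 (g : fps) : g 0%N = 1 -> g \is a GRing.unit.
Proof. by move=> g1; rewrite unfold_in /= /fps_unit g1. Qed.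

Lemma phi_unit : phi \is a GRing.unit.
Proof. by apply: unit_coef0; rewrite !coefs. Qed.

Lemma phim_unit : phim \is a GRing.unit.
Proof. by apply: unit_coef0; rewrite !coefs. Qed.

Lemma psi_unit : psi \is a GRing.unit.
Proof. by apply: unit_coef0; rewrite !coefs. Qed.

Lemma psi2_unit : psi2 \is a GRing.unit.
Proof. by apply: unit_coef0; rewrite !coefs. Qed.

Lemma flip_unit g : g \is a GRing.unit -> flip g \is a GRing.unit.
Proof. exact: rmorph_unit. Qed.

Lemma dil_unit k g : g \is a GRing.unit -> dil k.+1 g \is a GRing.unit.
Proof. exact: rmorph_unit. Qed.

Lemma theta_rel_phi : theta_rel X phi phi5 phim phim5 psi2 psi10.
Proof.
split; [exact: phi_psi2 | | exact: phi4 |].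
  have := congr1 flip phi_psi2.
  by rewrite !(rmorphB, rmorphXn, rmorphM, rmorph_nat) /= !flipE.
have := congr1 (dil 5) phi4; rewrite !(rmorphB, rmorphXn, rmorphM, rmorph_nat).
by rewrite /= -[X]expr1 dilX // /psi2 (@dil_dil 5 2 10).
Qed.

(** The constant terms are 2, 1, 1 and 1. *)
Lemma theta_nondeg_phi : theta_nondeg X phi phi5 phim phim5 psi2 psi10.
Proof.
have X0 : X 0%N = 0 by [].
by split; apply: neq0_coef0; rewrite !coefs // ?coefs ?X0.
Qed.

Lemma two_neq0 : 2 != 0 :> fps.
Proof. exact: nat_neq0. Qed.

(** The algebra yields the last clause only up to sign, through the equality of squares
    [psi_mul_sqr]. *)
Lemma psi_rel_psi : psi_rel X phi phi5 psi2 psi10 psi psi5.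
Proof.
have sqr5 : psi5 ^+ 2 = phi5 * psi10.
  have := congr1 (dil 5) psi_sqr; rewrite rmorphXn rmorphM /= => ->.
  by rewrite /psi2 (@dil_dil 5 2 10).
split=> //; first exact: psi_sqr.
have /eqP : (4 * X * psi * psi5 * (psi2 ^+ 2 - X ^+ 2 * psi10 ^+ 2)) ^+ 2
    = (phi5 * psi2 * (phi ^+ 2 - phi5 ^+ 2)) ^+ 2.
  transitivity (16 * X ^+ 2 * psi ^+ 2 * psi5 ^+ 2
                  * (psi2 ^+ 2 - X ^+ 2 * psi10 ^+ 2) ^+ 2); first by ring.
  rewrite psi_sqr sqr5.
  transitivity (phi5 * psi2 * (16 * X ^+ 2 * phi * psi10
                  * (psi2 ^+ 2 - X ^+ 2 * psi10 ^+ 2) ^+ 2)); first by ring.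
  rewrite (psi_mul_sqr _ _ _ theta_rel_phi theta_nondeg_phi);
    rewrite ?phi_unit ?phim_unit ?psi2_unit //.
  by ring.
rewrite eqf_sqr => /orP[/eqP // | /eqP e].
(* The sign is decided by the coefficient of q. *)
have X0 : X 0%N = 0 by [].
have X1 : X 1%N = 1 by [].
have phi51 : phi5 1%N = 0 by rewrite coef_dilN.
have e1 := congr1 (fun g : fps => g 1%N) e; rewrite fcoefN in e1.
have hL : (4 * X * psi * psi5 * (psi2 ^+ 2 - X ^+ 2 * psi10 ^+ 2)) 1%N = 4.
  rewrite -!mulrA fcoef_natM fcoef1M X0 X1 mul0r add0r mul1r.
  by rewrite !coefs // ?coefs X0.
have hR : (phi5 * psi2 * (phi ^+ 2 - phi5 ^+ 2)) 1%N = 4.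
  rewrite fcoef1M fcoefB !expr2 !fcoef1M phi51 !coefs // ?coefs coef1_phi.
  by rewrite subrr mulr0 addr0.
by rewrite hL hR in e1.
Qed.

Lemma psi_rel_psim : psi_rel (- X) phim phim5 psi2 psi10 psim psim5.
Proof.
have [/(congr1 flip) h1 /(congr1 flip) h2 /(congr1 flip) h3] := psi_rel_psi.
by split; [move: h1 | move: h2 | move: h3];
  rewrite !(rmorph_nat, rmorphB, rmorphXn, rmorphM) /= !flipE.
Qed.

(** * Even part and extraction of coefficients *)

Definition psi_main : fps :=
  psi ^+ 5 / psi5 - X * psi ^+ 3 * psi5 + 7 * X ^+ 2 * psi * psi5 ^+ 3
    + X ^+ 3 * psi5 ^+ 5 / psi.

Lemma phi_quot_even_part :
  phim5 ^+ 5 / phim + flip (phim5 ^+ 5 / phim) = 2 * dil 2 psi_main.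
Proof.
have -> : flip (phim5 ^+ 5 / phim) = phi5 ^+ 5 / phi.
  by rewrite rmorph_div ?phim_unit // rmorphXn /= flip_dil5 /phim flipK.
have dX : dil 2 X = X ^+ 2 by rewrite -[X]expr1 dilX.
have d10 : dil 2 psi5 = psi10 by exact: dil_dil.
rewrite (phi_quot_add two_neq0 X_neq0 phi_unit phim_unit psi2_unit _
  theta_rel_phi theta_nondeg_phi) ?dil_unit ?psi_unit //.
rewrite /psi_main !(rmorph_nat, rmorphD, rmorphN, rmorphXn, rmorphM) /=.
by rewrite !rmorphV ?dil_unit ?psi_unit //= dX d10 -/psi2; ring.
Qed.

Lemma coef_flip_even (g : fps) n : flip g = g -> odd n -> g n = 0.
Proof.
move=> /(congr1 (fun h : fps => h n)) e odd_n; apply/eqP.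
by rewrite -eqNr -[X in _ == X]e /flip -signr_odd odd_n expr1 mulN1r.
Qed.

(* 2 and 3 are not squares mod 5. *)
Lemma phi_phi5_coef n : (n %% 5 = 2)%N \/ (n %% 5 = 3)%N ->
  (phi * phi5 ^+ 3) n = 0.
Proof.
move=> n5; rewrite -[phi5 ^+ 3]rmorphXn fcoefM big1 //= => i _.
have [/dvdnP[j ij] | /coef_dilN->] := boolP (5 %| n - i)%N; last first.
  by rewrite mulr0.
rewrite /phi /gf (_ : level predT sq i = set0) ?fsbig_set0 ?mul0r //.
apply/seteqP; split=> // x /eqP xi; have := sqE x; rewrite xi => xx.
have : (i %% 5 = n %% 5)%N by have := leq_ord i; lia.
(* The square is reduced modulo 5 by hand, so that only linear arithmetic is left for each remainder
   [r]. *)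
have [y [r [xE r5]]] : exists y r, x = 5 * y + r /\ (0 <= r < 5).
  by exists (x %/ 5)%Z, (x %% 5)%Z; lia.
have [z iz] : exists z, i%:Z = 5 * z + r * r.
  by exists (5 * y * y + 2 * y * r); rewrite xx xE; ring.
have : r = 0 \/ r = 1 \/ r = 2 \/ r = 3 \/ r = 4 by lia.
by move=> r04; case: r04 iz => [|[|[|[|]]]] ->; lia.
Qed.

Lemma psi_main_coef n : odd n -> (n %% 5 = 2)%N \/ (n %% 5 = 3)%N ->
  psi_main n = 20 * (X ^+ 3 * (psi5 ^+ 5 / psi)) n.
Proof.
move=> odd_n n5; pose Y := psi_comb X phi phi5 psi psi5.
(* Since [psi_comb_opp] makes [Y] invariant under q -> -q, its odd coefficients vanish. *)
have Y0 : Y n = 0.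
  apply: coef_flip_even => //; rewrite [RHS](psi_comb_opp two_neq0 X_neq0
    _ _ _ _ _ _ theta_rel_phi theta_nondeg_phi _ _ _ _
    psi_rel_psi psi_rel_psim) ?(flip_unit, dil_unit);
    rewrite ?(phi_unit, phim_unit, psi_unit, psi2_unit) //.
  rewrite /Y /psi_comb !(rmorph_nat, rmorphD, rmorphN, rmorphXn, rmorphM) /=.
  by rewrite !rmorphV ?dil_unit ?psi_unit //= !flipE.
have -> : psi_main = Y + 20%:R * (X ^+ 3 * (psi5 ^+ 5 / psi))
                       + 2%:R * (phi * phi5 ^+ 3).
  by rewrite /psi_main /Y /psi_comb; ring.
by rewrite !fcoefD Y0 !fcoef_natM phi_phi5_coef // mulr0 addr0 add0r.
Qed.

Lemma psexpE (g : fps) k : psexp g k = g ^+ k :> fps.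
Proof. by elim: k => // k IHk; rewrite exprS -IHk. Qed.

Lemma psdivE (g h : fps) : h \is a GRing.unit -> psdiv g h = g / h :> fps.
Proof.
move=> hU; apply: fpsP => n; apply/esym; apply: (@psdiv_uniq g h (g / h : fps)).
  by have := hU; rewrite unfold_in.
by move=> m; rewrite -[RHS](congr1 (fun k : fps => k m) (divrK hU g)).
Qed.

Lemma abar5E : abar5 = phim5 ^+ 5 / phim :> fps.
Proof. by rewrite /abar5 phi_negE -psdivE ?phim_unit // -psexpE. Qed.

Lemma bbar5E : bbar5 = flip (psi5 ^+ 5 / psi) :> fps.
Proof.
rewrite /bbar5 psi_negE rmorph_div ?psi_unit // rmorphXn /= flip_dil5.
by rewrite -psdivE ?flip_unit ?psi_unit // -psexpE.
Qed.

Theorem corollary7 :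
  forall n : nat,
    abar5 (20 * n + 6)%N = 20%:Z * bbar5 (10 * n)%N /\
    abar5 (20 * n + 14)%N = 20%:Z * bbar5 (10 * n + 4)%N.
Proof.
(* The shift by 3 is the factor q^3 of the surviving term. As [m] is odd, [m - 3] is even, so the
   change q -> -q in [bbar5E] costs no sign. The claims are the cases [m = 10 * n + 3] and
   [m = 10 * n + 7]. *)
have main m : odd m -> (m %% 5 = 2)%N \/ (m %% 5 = 3)%N -> (3 <= m)%N ->
    abar5 (2 * m)%N = 20%:Z * bbar5 (m - 3)%N.
  move=> odd_m m5 m3; rewrite abar5E bbar5E.
  have := congr1 (fun g : fps => g (2 * m)%N) phi_quot_even_part.
  rewrite fcoefD fcoef_natM coef_dil // /flip mulnC exprM sqrr_sign mul1r.
  rewrite psi_main_coef // fcoefXnM m3 -[(-1) ^+ (m - 3)]signr_odd oddB //.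
  by rewrite odd_m mul1r; lia.
move=> n; split.
  have := main (10 * n + 3)%N; rewrite addnK.
  rewrite (_ : (2 * (10 * n + 3) = 20 * n + 6)%N); last by lia.
  by apply; lia.
have := main (10 * n + 7)%N.
rewrite (_ : (10 * n + 7 - 3 = 10 * n + 4)%N); last by lia.
rewrite (_ : (2 * (10 * n + 7) = 20 * n + 14)%N); last by lia.
by apply; lia.
Qed.
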